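(* Let $A\Rightarrow M$ be a Lie algebroid with anchor $\rho$, $\mathfrak{k}\subset A$ a bundle of ideals and $B=A/\mathfrak{k}$. Then $\mathfrak{k}$ is partially split if and only if there is a vector bundle splitting $l:A\to\mathfrak{k}$ of the short exact sequence $0\to\mathfrak{k}\to A\to B\to0$ (i.e. $l|_{\mathfrak{k}}=\mathrm{id}$) and a (usual) linear connection $\nabla$ on the vector bundle $A$ such that $$\overline\nabla l=0,\qquad l(R^{\mathrm{bas}}_\nabla)=0 .$$ In this case, the pair $(l,\nabla)$ determines an IM connection 1-form $(L,l)\in\Omega^1_{\mathrm{IM}}(A;\mathfrak{k})$ by setting $$L:\Gamma(A)\to\Omega^1(M;\mathfrak{k}),\qquad i_XL(\alpha):=l(\nabla_X\alpha).$$ Moreover, every IM connection 1-form $(L,l)$ takes this form for some pair $(l,\nabla)$ satisfying $\overline\nabla l=0$ and $l(R^{\mathrm{bas}}_\nabla)=0$.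
   Context: A bundle of ideals in a Lie algebroid $A\Rightarrow M$ (bracket $[\cdot,\cdot]$, anchor $\rho$) is a vector subbundle $\mathfrak{k}\subset\ker\rho$ with $[\alpha,\gamma]\in\Gamma(\mathfrak{k})$ for all $\alpha\in\Gamma(A)$, $\gamma\in\Gamma(\mathfrak{k})$. An IM connection 1-form for $\mathfrak{k}$ is a pair $(L,l)\in\Omega^1_{\mathrm{IM}}(A;\mathfrak{k})$ of a linear map $L:\Gamma(A)\to\Omega^1(M,\mathfrak{k})$ and a bundle map $l:A\to\mathfrak{k}$ with $l|_{\mathfrak{k}}=\mathrm{id}$, $L(f\alpha)=fL(\alpha)+df\otimes l(\alpha)$ and $$L([\alpha,\beta])=\mathcal{L}_\alpha L(\beta)-\mathcal{L}_\beta L(\alpha),\qquad l([\alpha,\beta])=[\alpha,l(\beta)]-i_{\rho(\beta)}L(\alpha),$$ where $(\mathcal{L}_\alpha\gamma)(X)=[\alpha,\gamma(X)]-\gamma([\rho(\alpha),X])$ for $\gamma\in\Omega^1(M,\mathfrak{k})$. $\mathfrak{k}$ is partially split if it admits an IM connection 1-form (equivalently, if there is a VB subalgebroid $E\Rightarrow TM$ of the tangent algebroid $TA\Rightarrow TM$ complementary to the image of $A\times_M\mathfrak{k}\hookrightarrow TA$, $(a,\gamma)\mapsto\frac{d}{d\tau}|_{0}(a+\tau\gamma)$). Given a linear connection $\nabla$ on $A$, the associated $A$-connections on $A$ and $TM$ are $$\overline\nabla_\alpha\beta:=\nabla_{\rho(\beta)}\alpha+[\alpha,\beta],\qquad\overline\nabla_\alpha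 X:=\rho(\nabla_X\alpha)+[\rho(\alpha),X].$$ The first restricts to $\mathfrak{k}$ as $\overline\nabla_\alpha\xi=[\alpha,\xi]$; the condition $\overline\nabla l=0$ means $\overline\nabla_\alpha(l(\beta))=l(\overline\nabla_\alpha\beta)$ for all $\alpha,\beta\in\Gamma(A)$. The basic curvature of $\nabla$ is the tensor $$R^{\mathrm{bas}}_\nabla(\alpha,\beta)(X):=\nabla_X([\alpha,\beta])-[\nabla_X\alpha,\beta]-[\alpha,\nabla_X\beta]-\nabla_{\overline\nabla_\beta X}\alpha+\nabla_{\overline\nabla_\alpha X}\beta$$ for $X\in\mathfrak{X}(M)$, $\alpha,\beta\in\Gamma(A)$. *)

(* Defs.v *)
From HB Require Import structures.
From mathcomp Require Import all_boot all_order all_algebra.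
From mathcomp Require Import all_classical all_reals topology normedtype derive.
From mathcomp Require Import ring.

Set Implicit Arguments.
Unset Strict Implicit.
Unset Printing Implicit Defensive.

Import Order.TTheory GRing.Theory Num.Theory.
Import numFieldNormedType.Exports.

Local Open Scope classical_set_scope.
Local Open Scope ring_scope.

Section EuclideanSmoothness.
Variables (R : realType) (n : nat).
Implicit Types (V : set 'rV[R]_n) (f g : 'rV[R]_n -> R).

(* Functions are total; only their values on the open set V matter. *)
Fixpoint Ck (k : nat) V f : Prop :=
  (forall x, V x -> {for x, continuous f}) /\
  match k with
  | 0 => True
  | k'.+1 => forall i : 'I_n,
      (forall x, V x -> derivable f x (delta_mx 0 i)) /\
      Ck k' V (fun x => 'D_(delta_mx 0 i) f x)
  end.

Definition Cinf V f : Prop := forall k, Ck k V f.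

Lemma Ck_eq k V f g : open V -> (forall x, V x -> f x = g x) ->
  Ck k V f -> Ck k V g.
Proof.
move=> oV; elim: k f g => [|k IH] f g fg [cf df].
all: have nfg x : V x -> \forall y \near x, f y = g y.
1,3: by move=> Vx; apply: filterS (open_nbhs_nbhs (conj oV Vx)) => y /fg.
all: split=> //.
1,2: move=> x Vx; change (g @ x --> g x); rewrite -(fg _ Vx).
1,2: exact: cvg_trans (near_eq_cvg (nfg x Vx)) (cf x Vx).
move=> i; have [dfi Cfi] := df i; split.
  by move=> x Vx; apply: near_eq_derivable (dfi x Vx); exact: nfg.
by apply: IH Cfi => // x Vx; apply: near_eq_derive; exact: nfg.
Qed.

Lemma CkW k V f : Ck k.+1 V f -> Ck k V f.
Proof.
elim: k f => [|k IH] f; first by case.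
move=> [cf df]; split => // i; have [dfi Cfi] := df i; split => //.
exact: (IH _ Cfi).
Qed.

Lemma Ck_cst k V (a : R) : Ck k V (fun=> a).
Proof.
elim: k a => [|k IH] a; (split; first by move=> x _; exact: cst_continuous) => //.
move=> i; split; first by move=> x _; exact: derivable_cst.
have -> : (fun x => 'D_(delta_mx 0 i) (fun=> a) x) = (fun=> 0) :> ('rV[R]_n -> R).
  by apply/funext => x; rewrite derive_cst.
exact: IH.
Qed.

Lemma CkD k V f g : open V -> Ck k V f -> Ck k V g ->
  Ck k V (fun x => f x + g x).
Proof.
move=> oV; elim: k f g => [|k IH] f g [cf df] [cg dg]; split => //.
- by move=> x Vx; exact: (continuousD (cf x Vx) (cg x Vx)).
- by move=> x Vx; exact: (continuousD (cf x Vx) (cg x Vx)).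
move=> i; have [dfi Cfi] := df i; have [dgi Cgi] := dg i; split.
  by move=> x Vx; apply: derivableD; [exact: dfi|exact: dgi].
apply: Ck_eq (IH _ _ Cfi Cgi) => // x Vx.
by rewrite /= -deriveD //; [exact: dfi|exact: dgi].
Qed.

Lemma CkM k V f g : open V -> Ck k V f -> Ck k V g ->
  Ck k V (fun x => f x * g x).
Proof.
move=> oV; elim: k f g => [|k IH] f g Cf Cg; have [cf df] := Cf;
  have [cg dg] := Cg; split => //.
- by move=> x Vx; exact: (continuousM (cf x Vx) (cg x Vx)).
- by move=> x Vx; exact: (continuousM (cf x Vx) (cg x Vx)).
move=> i; have [dfi Cfi] := df i; have [dgi Cgi] := dg i; split.
  by move=> x Vx; apply: derivableM; [exact: dfi|exact: dgi].
have Ef := IH _ _ (CkW Cf) Cgi; have Eg := IH _ _ (CkW Cg) Cfi.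
apply: Ck_eq (CkD oV Ef Eg) => // x Vx.
by rewrite /= (@deriveM _ _ f g) //; [exact: dfi|exact: dgi].
Qed.

End EuclideanSmoothness.

(* A chart is given with total functions both ways; values of [ch_map] outside
   [ch_dom] and of [ch_inv] outside [ch_cod] are irrelevant. *)
Record chart (R : realType) (n : nat) (T : topologicalType) := Chart {
  ch_dom : set T;
  ch_cod : set 'rV[R]_n;
  ch_map : T -> 'rV[R]_n;
  ch_inv : 'rV[R]_n -> T;
  ch_dom_open : open ch_dom;
  ch_cod_open : open ch_cod;
  ch_map_cod : forall p, ch_dom p -> ch_cod (ch_map p);
  ch_inv_dom : forall x, ch_cod x -> ch_dom (ch_inv x);
  ch_mapK : forall p, ch_dom p -> ch_inv (ch_map p) = p;
  ch_invK : forall x, ch_cod x -> ch_map (ch_inv x) = x;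
  ch_map_cont : forall p, ch_dom p -> {for p, continuous ch_map};
  ch_inv_cont : forall x, ch_cod x -> {for x, continuous ch_inv}
}.

Definition chart_image (R : realType) n (T : topologicalType)
  (c : chart R n T) (U : set T) : set 'rV[R]_n :=
  [set x | ch_cod c x /\ U (ch_inv c x)].

Record manifold (R : realType) (n : nat) := Manifold {
  mf_space :> topologicalType;
  mf_atlas : set (chart R n mf_space);
  mf_hausdorff : hausdorff_space mf_space;
  mf_second_countable : @second_countable mf_space;
  mf_cover : forall p : mf_space, exists2 c, mf_atlas c & ch_dom c p;
  mf_compat : forall c d, mf_atlas c -> mf_atlas d -> forall i : 'I_n,
    Cinf (chart_image c (ch_dom d)) (fun x => ch_map d (ch_inv c x) 0 i)
}.

Section SmoothFunctions.
Variables (R : realType) (n : nat) (M : manifold R n).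

Definition smooth_on (U : set M) (f : M -> R) : Prop :=
  forall c, mf_atlas c -> Cinf (chart_image c U) (fun x => f (ch_inv c x)).

Lemma chart_image_open (c : chart R n M) (U : set M) :
  open U -> open (chart_image c U).
Proof.
move=> oU; rewrite openE => x [cx Ux].
have nU : nbhs (ch_inv c x) U by exact: open_nbhs_nbhs.
have := ch_inv_cont cx nU.
have : nbhs x (ch_cod c) by apply: open_nbhs_nbhs; split => //; exact: ch_cod_open.
by move=> h1 h2; apply: filterS2 h1 h2 => y; split.
Qed.

Lemma smooth_on_cst U (a : R) : smooth_on U (fun=> a).
Proof. by move=> c _ k; exact: Ck_cst. Qed.

Lemma smooth_onD U f g : open U -> smooth_on U f -> smooth_on U g ->
  smooth_on U (fun p => f p + g p).
Proof.
move=> oU sf sg c ac k.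
by apply: CkD (sf c ac k) (sg c ac k); exact: chart_image_open.
Qed.

Lemma smooth_onM U f g : open U -> smooth_on U f -> smooth_on U g ->
  smooth_on U (fun p => f p * g p).
Proof.
move=> oU sf sg c ac k.
by apply: CkM (sf c ac k) (sg c ac k); exact: chart_image_open.
Qed.

Lemma smooth_onS U V f : V `<=` U -> smooth_on U f -> smooth_on V f.
Proof.
move=> VU sf c ac k; have := sf c ac k.
have : chart_image c V `<=` chart_image c U by move=> x [? ?]; split => //; exact: VU.
move: (chart_image _ V) (chart_image _ U) (fun x => f _) => A B h AB.
elim: k h => [|k IH] h [ch dh]; split => //; try by move=> x /AB /ch.
by move=> i; have [dhi Ci] := dh i; split; [move=> x /AB /dhi|exact: IH].
Qed.

Definition is_smooth : {pred M -> R} := fun f => `[< smooth_on setT f >].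

Fact is_smooth_subring : subring_closed is_smooth.
Proof.
split.
- by apply/asboolP; exact: smooth_on_cst.
- move=> f g /asboolP sf /asboolP sg; apply/asboolP.
  have -> : f - g = fun p => f p + (- 1) * g p.
    by apply/funext => p; rewrite mulN1r.
  apply: smooth_onD => //; first exact: openT.
  by apply: smooth_onM => //; [exact: openT|exact: smooth_on_cst].
- move=> f g /asboolP sf /asboolP sg; apply/asboolP.
  by apply: (@smooth_onM setT f g) => //; exact: openT.
Qed.

HB.instance Definition _ :=
  GRing.isSubringClosed.Build (M -> R) is_smooth is_smooth_subring.

Record smooth_fun := SmoothFun {
  sm_val :> M -> R;
  sm_valP : sm_val \in is_smooth
}.

HB.instance Definition _ := [isSub for sm_val].
HB.instance Definition _ := [Choice of smooth_fun by <:].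
HB.instance Definition _ := GRing.SubChoice_isSubComPzRing.Build
  (M -> R) is_smooth smooth_fun is_smooth_subring.

Lemma smooth_funD (f g : smooth_fun) p : (f + g) p = f p + g p.
Proof. by []. Qed.

Lemma smooth_funM (f g : smooth_fun) p : (f * g) p = f p * g p.
Proof. by []. Qed.

Lemma smooth_funP (f : smooth_fun) : smooth_on setT f.
Proof. exact: asboolP (sm_valP f). Qed.

Lemma smooth_fun_ext (f g : smooth_fun) : (forall p, f p = g p) -> f = g.
Proof. by move=> fg; apply: val_inj; apply/funext. Qed.

Definition mk_smooth (f : M -> R) (sf : smooth_on setT f) : smooth_fun :=
  SmoothFun (asboolT sf).

Definition const_fun (a : R) : smooth_fun := mk_smooth (smooth_on_cst setT a).

End SmoothFunctions.

(* The common interface of the tangent bundle and of vector bundles: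
   [sf_smooth U s] says that s is a smooth section over the open set U.  Sections
   are total; only their values on U matter. *)
Record sfamily (R : realType) n (M : manifold R n) := SFamily {
  sf_fib :> M -> lmodType R;
  sf_smooth : set M -> (forall p, sf_fib p) -> Prop;
  sf_smooth0 : forall U, open U -> sf_smooth U (fun p => 0);
  sf_smoothD : forall U s t, open U -> sf_smooth U s -> sf_smooth U t ->
    sf_smooth U (fun p => s p + t p);
  sf_smoothZ : forall U f s, open U -> smooth_on U f -> sf_smooth U s ->
    sf_smooth U (fun p => f p *: s p)
}.

Section Sections.
Variables (R : realType) (n : nat) (M : manifold R n) (E : sfamily M).

Record section := Section_ {
  sec_val :> forall p, E p;
  secP : sf_smooth setT sec_val
}.
Implicit Types (s t : section) (f : smooth_fun M).

Lemma sec_ext s t : (forall p, s p = t p) -> s = t.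
Proof.
case: s t => [s hs] [t ht] /= st.
have e : s = t by apply: functional_extensionality_dep.
by case: _ / e ht => ht; congr Section_; exact: Prop_irrelevance.
Qed.

HB.instance Definition _ := gen_eqMixin section.
HB.instance Definition _ := gen_choiceMixin section.

Definition sec0 : section := Section_ (sf_smooth0 E openT).
Definition secD s t : section :=
  Section_ (sf_smoothD openT (secP s) (secP t)).
Definition secZ f s : section :=
  Section_ (sf_smoothZ openT (smooth_funP f) (secP s)).
Definition secN s : section := secZ (const_fun M (-1)) s.

Fact secDA : associative secD.
Proof. by move=> s t u; apply: sec_ext => p /=; rewrite addrA. Qed.
Fact secDC : commutative secD.
Proof. by move=> s t; apply: sec_ext => p /=; rewrite addrC. Qed.
Fact sec0D : left_id sec0 secD.
Proof. by move=> s; apply: sec_ext => p /=; rewrite add0r. Qed.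
Fact secND : left_inverse sec0 secN secD.
Proof. by move=> s; apply: sec_ext => p /=; rewrite scaleN1r addNr. Qed.

HB.instance Definition _ :=
  GRing.isZmodule.Build section secDA secDC sec0D secND.

Fact secZA f g s : secZ f (secZ g s) = secZ (f * g) s.
Proof. by apply: sec_ext => p /=; rewrite scalerA. Qed.
Fact sec1Z : left_id 1 secZ.
Proof. by move=> s; apply: sec_ext => p /=; rewrite scale1r. Qed.
Fact secZDr : right_distributive secZ +%R.
Proof. by move=> f s t; apply: sec_ext => p /=; rewrite scalerDr. Qed.
Fact secZDl s : {morph secZ^~ s : f g / f + g}.
Proof. by move=> f g; apply: sec_ext => p /=; rewrite scalerDl. Qed.

HB.instance Definition _ :=
  GRing.Zmodule_isLmodule.Build (smooth_fun M) section secZA sec1Z secZDr secZDl.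

Lemma sec_addE s t p : (s + t) p = s p + t p. Proof. by []. Qed.
Lemma sec_scaleE f s p : (f *: s) p = f p *: s p. Proof. by []. Qed.
Lemma sec_zeroE p : (0 : section) p = 0. Proof. by []. Qed.
Lemma sec_oppE s p : (- s) p = - s p. Proof. exact: scaleN1r. Qed.

End Sections.

(* Covering the identity of M.  Smoothness is tested on smooth local sections,
   in particular on local frames. *)
Record bundle_map (R : realType) n (M : manifold R n) (E F : sfamily M) :=
BundleMap {
  bm_fun :> forall p, {linear E p -> F p};
  bm_smooth : forall U s, open U ->
    @sf_smooth R n M E U s -> @sf_smooth R n M F U (fun p => bm_fun p (s p))
}.

Definition bm_app (R : realType) n (M : manifold R n) (E F : sfamily M)
    (h : bundle_map E F) (s : section E) : section F :=
  Section_ (bm_smooth h openT (secP s)).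

Local Obligation Tactic := idtac.

Section Tangent.
Variables (R : realType) (n : nat) (M : manifold R n).

(* The tangent space at p is the space of derivations at p of the algebra of
   smooth functions. *)
Record tangent (p : M) := Tangent {
  tg_val :> smooth_fun M -> R;
  tg_linear : forall a f g,
    tg_val (const_fun M a * f + g) = a * tg_val f + tg_val g;
  tg_leibniz : forall f g,
    tg_val (f * g) = f p * tg_val g + tg_val f * g p
}.

Lemma tg_ext p (v w : tangent p) : (forall f, v f = w f) -> v = w.
Proof.
case: v w => [v v1 v2] [w w1 w2] /= vw.
have e : v = w by apply/funext.
by case: _ / e w1 w2 => w1 w2; congr Tangent; exact: Prop_irrelevance.
Qed.

Section TangentSpace.
Variable p : M.
Implicit Types v w : tangent p.

HB.instance Definition _ := gen_eqMixin (tangent p).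
HB.instance Definition _ := gen_choiceMixin (tangent p).

Program Definition tg0 : tangent p := @Tangent p (fun=> 0) _ _.
Next Obligation. by move=> * /=; rewrite mulr0 addr0. Qed.
Next Obligation. by move=> * /=; rewrite mulr0 mul0r addr0. Qed.

Program Definition tgD v w : tangent p := @Tangent p (fun f => v f + w f) _ _.
Next Obligation. by move=> v w a f g /=; rewrite !tg_linear; ring. Qed.
Next Obligation. by move=> v w f g /=; rewrite !tg_leibniz; ring. Qed.

Program Definition tgZ a v : tangent p := @Tangent p (fun f => a * v f) _ _.
Next Obligation. by move=> a v b f g /=; rewrite !tg_linear; ring. Qed.
Next Obligation. by move=> a v f g /=; rewrite !tg_leibniz; ring. Qed.

Definition tgN v : tangent p := tgZ (-1) v.

Fact tgDA : associative tgD.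
Proof. by move=> u v w; apply: tg_ext => f /=; rewrite addrA. Qed.
Fact tgDC : commutative tgD.
Proof. by move=> u v; apply: tg_ext => f /=; rewrite addrC. Qed.
Fact tg0D : left_id tg0 tgD.
Proof. by move=> u; apply: tg_ext => f /=; rewrite add0r. Qed.
Fact tgND : left_inverse tg0 tgN tgD.
Proof. by move=> u; apply: tg_ext => f /=; rewrite mulN1r addNr. Qed.

HB.instance Definition _ :=
  GRing.isZmodule.Build (tangent p) tgDA tgDC tg0D tgND.

Fact tgZA a b v : tgZ a (tgZ b v) = tgZ (a * b) v.
Proof. by apply: tg_ext => f /=; rewrite mulrA. Qed.
Fact tg1Z : left_id 1 tgZ.
Proof. by move=> v; apply: tg_ext => f /=; rewrite mul1r. Qed.
Fact tgZDr : right_distributive tgZ +%R.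
Proof. by move=> a u v; apply: tg_ext => f /=; rewrite mulrDr. Qed.
Fact tgZDl v : {morph tgZ^~ v : a b / a + b}.
Proof. by move=> a b; apply: tg_ext => f /=; rewrite mulrDl. Qed.

HB.instance Definition _ :=
  GRing.Zmodule_isLmodule.Build R (tangent p) tgZA tg1Z tgZDr tgZDl.

End TangentSpace.

Definition tangent_smooth (U : set M) (X : forall p, tangent p) : Prop :=
  forall f : smooth_fun M, smooth_on U (fun p => X p f).

Program Definition tangent_bundle : sfamily M :=
  @SFamily R n M (fun p => tangent p) tangent_smooth _ _ _.
Next Obligation. by move=> U oU f; exact: smooth_on_cst. Qed.
Next Obligation. by move=> U s t oU ss st f; exact: smooth_onD. Qed.
Next Obligation. by move=> U h s oU sh ss f; exact: smooth_onM. Qed.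

Definition vector_field := section tangent_bundle.

Definition vf_app (X : vector_field) (f : smooth_fun M) : smooth_fun M :=
  mk_smooth (secP X f).

Program Definition vf_bracket (X Y : vector_field) : vector_field :=
  @Section_ R n M tangent_bundle
    (fun p => @Tangent p (fun f => X p (vf_app Y f) - Y p (vf_app X f)) _ _) _.
Next Obligation.
move=> X Y p a f g /=.
have E Z : vf_app Z (const_fun M a * f + g) =
    const_fun M a * vf_app Z f + vf_app Z g.
  by apply: smooth_fun_ext => q; rewrite /= tg_linear.
by rewrite !E !tg_linear; ring.
Qed.
Next Obligation.
move=> X Y p f g /=.
have E Z : vf_app Z (f * g) = f * vf_app Z g + vf_app Z f * g.
  by apply: smooth_fun_ext => q; rewrite /= tg_leibniz.
have D q (v : tangent q) f1 f2 : v (f1 + f2) = v f1 + v f2.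
  have := tg_linear v 1 f1 f2; rewrite mul1r => <-; congr (v (_ + _)).
  by apply: smooth_fun_ext => x; rewrite /= mul1r.
by rewrite !E !D !tg_leibniz /=; ring.
Qed.
Next Obligation.
move=> X Y f /=.
exact: smooth_funP (vf_app X (vf_app Y f) - vf_app Y (vf_app X f)).
Qed.

End Tangent.

Arguments vf_app {R n M} X f.
Arguments vf_bracket {R n M} X Y.

Record frame (R : realType) (T : Type) (E : T -> vectType R) := Frame {
  fr_dom : set T;
  fr_rank : nat;
  fr_sec :> forall p, fr_rank.-tuple (E p)
}.

(* A smooth vector bundle, given by its fibres and an atlas of local frames
   (equivalently, of local trivializations) with smooth transition functions.
   The rank is locally constant, but need not be constant when M is
   disconnected. *)
Record vector_bundle (R : realType) n (M : manifold R n) := VectorBundle {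
  vb_fib : M -> vectType R;
  vb_atlas : set (frame vb_fib);
  vb_open : forall e, vb_atlas e -> open (fr_dom e);
  vb_basis : forall e p, vb_atlas e -> fr_dom e p -> basis_of fullv (e p);
  vb_cover : forall p, exists2 e, vb_atlas e & fr_dom e p;
  vb_compat : forall e e', vb_atlas e -> vb_atlas e' ->
    forall (i : 'I_(fr_rank e)) (j : 'I_(fr_rank e')),
    smooth_on (fr_dom e `&` fr_dom e') (fun p => coord (e p) i (tnth (e' p) j))
}.

Section VectorBundleSections.
Variables (R : realType) (n : nat) (M : manifold R n) (E : vector_bundle M).

Definition vb_smooth (U : set M) (s : forall p, vb_fib E p) : Prop :=
  forall e, vb_atlas e -> forall i : 'I_(fr_rank e),
  smooth_on (U `&` fr_dom e) (fun p => coord (e p) i (s p)).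

Program Definition vb_family : sfamily M :=
  @SFamily R n M (fun p => vb_fib E p) vb_smooth _ _ _.
Next Obligation.
move=> U oU e ae i.
have -> : (fun p => coord (e p) i 0) = (fun=> 0 : R) :> (M -> R).
  by apply/funext => p; rewrite linear0.
exact: smooth_on_cst.
Qed.
Next Obligation.
move=> U s t oU ss st e ae i.
have -> : (fun p => coord (e p) i (s p + t p)) =
    (fun p => coord (e p) i (s p) + coord (e p) i (t p)).
  by apply/funext => p; rewrite linearD.
by apply: smooth_onD (ss e ae i) (st e ae i); apply: openI => //; exact: vb_open.
Qed.
Next Obligation.
move=> U f s oU sf ss e ae i.
have -> : (fun p => coord (e p) i (f p *: s p)) =
    (fun p => f p * coord (e p) i (s p)).
  by apply/funext => p; rewrite linearZ.
have oUe : open (U `&` fr_dom e) by apply: openI => //; exact: vb_open.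
by apply: smooth_onM (ss e ae i) => //; apply: smooth_onS sf; exact: subIsetl.
Qed.

(* Local frame criterion: subspaces of the fibres form a vector subbundle when
   they are spanned, near every point, by a smooth local frame. *)
Definition is_subbundle (k : forall p, {vspace vb_fib E p}) : Prop :=
  forall p, exists U : set M, exists m : nat,
    exists s : 'I_m -> forall q, vb_fib E q,
    [/\ open U, U p, forall i, vb_smooth U (s i) &
        forall q, U q -> basis_of (k q) [tuple s i q | i < m]].

End VectorBundleSections.

Coercion vb_family : vector_bundle >-> sfamily.

(* Compatibility of the anchor with brackets is a consequence of the Jacobi
   identity and the Leibniz rule. *)
Record lie_algebroid (R : realType) n (M : manifold R n) := LieAlgebroid {
  la_bundle :> vector_bundle M;
  la_anchor : bundle_map la_bundle (tangent_bundle M);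
  la_bracket : section la_bundle -> section la_bundle -> section la_bundle;
  la_linear : forall (a : R) x y z,
    la_bracket (const_fun M a *: x + y) z =
    const_fun M a *: la_bracket x z + la_bracket y z;
  la_anti : forall x y, la_bracket x y = - la_bracket y x;
  la_jacobi : forall x y z,
    la_bracket x (la_bracket y z) + la_bracket y (la_bracket z x)
      + la_bracket z (la_bracket x y) = 0;
  la_leibniz : forall x (f : smooth_fun M) y,
    la_bracket x (f *: y) =
    f *: la_bracket x y + vf_app (bm_app la_anchor x) f *: y
}.

Section LieAlgebroid.
Variables (R : realType) (n : nat) (M : manifold R n) (A : lie_algebroid M).

Local Notation "[[ x , y ]]" := (la_bracket x y).
Local Notation "[X[ X , Y ]]" := (vf_bracket X Y).
Local Notation rho := (bm_app (la_anchor A)).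

Implicit Types (k : forall p, {vspace vb_fib A p}) (x y z : section A)
  (X Y : vector_field M) (f : smooth_fun M) (l : bundle_map A A).

Definition section_in k x : Prop := forall p, x p \in k p.

Definition is_ideal_bundle k : Prop :=
  [/\ is_subbundle k,
      (forall p v, v \in k p -> la_anchor A p v = 0) &
      (forall x z, section_in k z -> section_in k [[x, z]])].

(* Elements of Omega^1(M; k), as C^oo(M)-linear maps from vector fields to
   sections of k. *)
Definition is_one_form k (g : vector_field M -> section A) : Prop :=
  linear g /\ forall X, section_in k (g X).

(* The Lie derivative (L_x g)(X). *)
Definition lie_form x (g : vector_field M -> section A) X : section A :=
  [[x, g X]] - g [X[rho x, X]].

(* A bundle map A -> k is a bundle map A -> A with values in k. *)
Definition is_splitting k l : Prop :=
  (forall p v, l p v \in k p) /\ (forall p v, v \in k p -> l p v = v).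

(* [L x X] is i_X L(x). *)
Record is_IM_connection k
    (L : section A -> vector_field M -> section A) l : Prop := IMConnection {
  im_splitting : is_splitting k l;
  im_form : forall x, is_one_form k (L x);
  im_linear : forall (a : R) x y X,
    L (const_fun M a *: x + y) X = const_fun M a *: L x X + L y X;
  im_leibniz : forall f x X,
    L (f *: x) X = f *: L x X + vf_app X f *: bm_app l x;
  im_bracketL : forall x y X,
    L [[x, y]] X = lie_form x (L y) X - lie_form y (L x) X;
  im_bracketl : forall x y,
    bm_app l [[x, y]] = [[x, bm_app l y]] - L x (rho y)
}.

Definition partially_split k : Prop := exists L l, is_IM_connection k L l.

(* [D X x] is the covariant derivative of x along X. *)
Definition is_connection (D : vector_field M -> section A -> section A) : Prop :=
  [/\ (forall x, linear (D^~ x)),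
      (forall (a : R) X x y,
         D X (const_fun M a *: x + y) = const_fun M a *: D X x + D X y) &
      (forall X f x, D X (f *: x) = f *: D X x + vf_app X f *: x)].

Variable D : vector_field M -> section A -> section A.

Definition conn_A x y : section A := D (rho y) x + [[x, y]].

Definition conn_TM x X : vector_field M := rho (D X x) + [X[rho x, X]].

Definition basic_curvature x y X : section A :=
  D X [[x, y]] - [[D X x, y]] - [[x, D X y]]
  - D (conn_TM y X) x + D (conn_TM x X) y.

Definition l_parallel l : Prop :=
  forall x y, conn_A x (bm_app l y) = bm_app l (conn_A x y).

Definition l_basic_flat l : Prop :=
  forall x y X, bm_app l (basic_curvature x y X) = 0.

End LieAlgebroid.

(* Main.v *)
(* The algebraic part amounts to l-projecting the two defining identities: since
   rho o l = 0, parallelism of l is the bracket identity for l with L = l o nabla,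
   and then l(R^bas) is exactly the defect of the bracket identity for L.  Conversely,
   for any connection nabla0 on A, nabla := nabla0 - l o nabla0 + L is a connection
   with l o nabla = L.

   The existence of nabla0 is proved without partitions of unity.  If g is a bump
   function supported in the domain of a local frame e_j with coordinates c_j, then
   X, x |-> sum_j X(g c_j(x)) g e_j is a global operator satisfying the Leibniz rule
   with X(f) replaced by g^2 X(f).  Such weighted connections D_i, of weights w_i,
   are accumulated along a countable cover {w_i = 1} by
   F_(i+1) = F_i + (1 - W_i) D_i, W_(i+1) = W_i + (1 - W_i) w_i,
   which is stationary, with weight 1, near every point. *)

Require Import Defs.
From mathcomp Require Import all_boot all_order all_algebra.
From mathcomp Require Import all_classical all_reals topology normedtype derive.
From mathcomp Require Import realfun sequences exp ring lra.

Set Implicit Arguments.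
Unset Strict Implicit.
Unset Printing Implicit Defensive.

Import Order.TTheory GRing.Theory Num.Theory.
Import numFieldNormedType.Exports.

Local Open Scope classical_set_scope.
Local Open Scope ring_scope.

(** * Flat functions of one real variable *)

Section Flat.
Variable R : realType.
Implicit Types (t : R) (m : nat).

(** Negative powers multiply exp(-1/t) so that derivatives stay in the linear span of the family;
    [flat 0] is the classical smooth function that is not analytic at 0. *)
Definition flat m t : R := if 0 < t then t ^- m * expR (- t^-1) else 0.

Lemma flat_le0 m t : t <= 0 -> flat m t = 0.
Proof. by rewrite /flat leNgt => /negPf ->. Qed.

Lemma flat_ge0 m t : 0 <= flat m t.
Proof.
rewrite /flat; case: ifP => // t0.
by rewrite mulr_ge0 ?expR_ge0 // invr_ge0 exprn_ge0 // ltW.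
Qed.

(** For t > 0 the exponential series at 1/t dominates its term of degree m+1, hence t^-(m+1) <=
    (m+1)! exp(1/t). This controls the difference quotients at 0. *)
Lemma flat_bound m t : flat m t <= m.+1`!%:R * `|t|.
Proof.
rewrite /flat; case: ifP => [t0|_]; last by rewrite mulr_ge0.
rewrite gtr0_norm // expRN ler_pdivrMr ?expR_gt0 //.
have := @expR_ge1Dxn R t^-1 m; rewrite invr_ge0 ltW // => /(_ isT) h.
have f0 : 0 < m.+1`!%:R :> R by rewrite ltr0n fact_gt0.
have {h} : t ^- m.+1 <= m.+1`!%:R * expR t^-1.
  rewrite -ler_pdivrMl // mulrC -exprVn; apply: le_trans h; lra.
rewrite -(ler_pM2l t0) => h; apply: le_trans (le_trans h _).
  by rewrite exprS invfM mulrA mulfV ?mul1r // gt_eqF.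
by rewrite mulrCA mulrA.
Qed.

Lemma is_derive_flat m t :
  is_derive t 1 (flat m) (flat m.+2 t - m%:R * flat m.+1 t).
Proof.
have [t0|t0|->] := ltrgtP t 0.
- rewrite !flat_le0 ?ltW // mulr0 subrr.
  have ? : is_derive t 1 (fun=> 0 : R) (0 : R) by exact: is_derive_cst.
  apply: (@near_eq_is_derive _ _ _ (fun=> 0)).
  by near=> s; rewrite flat_le0 // ltW //; near: s; exact: lt_nbhsl.
- have tn0 : t != 0 by rewrite gt_eqF.
  have dV : is_derive t 1 (fun s : R => s^-1) (- t ^- 2).
    apply: DeriveDef; first exact: derivableV.
    by rewrite deriveV // derive_id [_ *: _]mulr1.
  have dE : is_derive t 1 (expR \o (fun s : R => - s^-1))
      (expR (- t^-1) * t ^- 2).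
    by rewrite -[t ^- 2]opprK; apply: is_derive1_comp; exact: is_deriveN.
  have d : is_derive t 1 (fun s => s ^- m * expR (- s^-1))
      (flat m.+2 t - m%:R * flat m.+1 t).
    have -> : (fun s => s ^- m * expR (- s^-1)) =
      (fun s : R => s^-1) ^+ m * (expR \o (fun s : R => - s^-1)).
      apply/funext => s; rewrite -[RHS]/(((fun s : R => s^-1) ^+ m) s * _).
      by rewrite exprfctE exprVn.
    (* With y = 1/t the claim is a polynomial identity; [m = 0] is split off because of the exponent
       [m.-1]. *)
    have key (E y : R) :
        y ^+ m * (E * y ^+ 2) + E * (m%:R * y ^+ m.-1 * - y ^+ 2) =
        y * (y * y ^+ m) * E - m%:R * (y * y ^+ m * E).
      by case: m => [|m]; rewrite ?(exprS y m) /=; ring.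
    apply: is_derive_eq (is_deriveM (is_deriveX _ dV) dE) _.
    rewrite exprfctE /flat t0 /GRing.scale /= -!exprVn.
    rewrite (exprS t^-1 m.+1) !(exprS t^-1 m).
    exact: key.
  apply: near_eq_is_derive d; near=> s; rewrite /flat ifT //.
  by near: s; exact: lt_nbhsr.
- rewrite !flat_le0 // mulr0 subrr.
  (* At 0 the difference quotient vanishes on the left and equals [flat m.+1] on the right, so
     [flat_bound] squeezes it to 0. *)
  have h : h^-1 *: ((flat m \o shift 0) (h *: 1) - flat m 0) @[h --> 0^']
      --> (0 : R).
    apply: norm_cvg0.
    have c : (m.+2`!%:R : R) * `|h| @[h --> (0:R)^'] --> (0 : R).
      have i : h @[h --> (0:R)^'] --> (0 : R) by exact: nbhs_dnbhs.
      have := cvgM (cvg_cst (m.+2`!%:R : R)) (cvg_norm i).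
      by rewrite normr0 mulr0; apply.
    apply: squeeze_cvgr (cvg_cst 0) c; near=> s.
    rewrite normr_ge0 /= addr0 (@flat_le0 m 0) // subr0 [_ *: 1]mulr1.
    have s0 : s != 0 by near: s; exact: nbhs_dnbhs_neq.
    have [s1|s1] := leP s 0.
      by rewrite flat_le0 // scaler0 normr0 mulr_ge0.
    suff -> : s^-1 *: flat m s = flat m.+1 s.
      by rewrite (ger0_norm (flat_ge0 _ _)) flat_bound.
    by rewrite /flat s1 [_ *: _]mulrA exprS invfM.
  by apply: DeriveDef; [apply/cvg_ex; exists 0|apply: cvg_lim].
Unshelve. all: by end_near.
Qed.
  End Flat.

(** Restriction to the line through [x] in direction [v] reduces this to the one-variable chain
    rule, asking of [u] only derivability along [v], as supplied by [Ck]. *)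
Lemma is_derive_compr (R : realType) (V : normedModType R) (g : R -> R)
    (u : V -> R) (x v : V) (a : R) :
  is_derive (u x) 1 g a -> derivable u x v ->
  is_derive x v (g \o u) (a * 'D_v u x).
Proof.
have along (f : V -> R) : 'D_v f x = 'D_1 (fun h : R => f (h *: v + x)) 0.
  rewrite /derive; set g1 := fun h => h^-1 *: _; set g2 := fun h => h^-1 *: _.
  suff -> : g1 = g2 by []; apply/funext => h; rewrite /g1 /g2 /=.
  by rewrite addr0 scale0r add0r [_%:A]mulr1.
move=> dg /derivable1P du.
have dg0 : is_derive (u ((0 : R) *: v + x)) 1 g a by rewrite scale0r add0r.
have := is_derive1_comp dg0 (derivableP du); rewrite -along => -[d1 d2].
by split; [exact/derivable1P|rewrite along].
Qed.

(** * Locality of C^k and composition with flat functions *)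

Section EuclideanSmoothness.
Variables (R : realType) (n : nat).
Implicit Types (V : set 'rV[R]_n) (f u : 'rV[R]_n -> R).

Lemma Ck_local k V f :
  (forall x, V x -> exists W, [/\ open W, W x & Ck k W f]) -> Ck k V f.
Proof.
elim: k f => [|k IH] f loc; split => //.
- by move=> x /loc [W [_ Wx [cf _]]]; exact: cf.
- by move=> x /loc [W [_ Wx [cf _]]]; exact: cf.
move=> i; split=> [x /loc [W [_ Wx [_ /(_ i) [df _]]]]|]; first exact: df.
by apply: IH => x /loc [W [oW Wx [_ /(_ i) [_ Cf]]]]; exists W.
Qed.

(** Differentiating [flat m] produces [flat m.+1] and [flat m.+2], so the induction on [k] is
    uniform in [m]. *)
Lemma Ck_flat k V u m : open V -> Ck k V u -> Ck k V (fun x => flat m (u x)).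
Proof.
move=> oV; have cflat m' t : {for t, continuous (@flat R m')}.
  apply/differentiable_continuous/derivable1_diffP.
  by have [] := is_derive_flat m' t.
have dflat u' m' x v : derivable u' x v -> is_derive x v (flat m' \o u')
    ((flat m'.+2 (u' x) - m'%:R * flat m'.+1 (u' x)) * 'D_v u' x).
  by apply: is_derive_compr; exact: is_derive_flat.
elim: k u m => [|k IH] u m Cu; have [cu du] := Cu.
  by split => // x Vx; exact: continuous_comp (cu x Vx) (cflat _ _).
split; first by move=> x Vx; exact: continuous_comp (cu x Vx) (cflat _ _).
move=> i; have [dui Cui] := du i; split.
  by move=> x Vx; have [] := dflat u m _ _ (dui x Vx).
apply: Ck_eq (CkM oV (CkD oV (IH _ m.+2 (CkW Cu))
  (CkM oV (Ck_cst _ _ (- m%:R)) (IH _ m.+1 (CkW Cu)))) Cui) => // x Vx.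
by have [_ ->] := dflat u m _ _ (dui x Vx); rewrite mulNr.
Qed.
End EuclideanSmoothness.

(** * Smooth functions on a manifold and bump functions *)

Section SmoothFunctions.
Variables (R : realType) (n : nat) (M : manifold R n).
Implicit Types (U V C : set M) (f g : M -> R).

Lemma smooth_on_local U f :
  (forall p, U p -> exists W, [/\ open W, W p & smooth_on W f]) ->
  smooth_on U f.
Proof.
move=> loc c ac k; apply: Ck_local => x [cx Ux].
have [W [oW Wx sf]] := loc _ Ux.
by exists (chart_image c W); split; [exact: chart_image_open| |exact: sf].
Qed.

Lemma smooth_on_eq U f g : open U -> (forall p, U p -> f p = g p) ->
  smooth_on U f -> smooth_on U g.
Proof.
move=> oU fg sf c ac k; apply: Ck_eq (sf c ac k); first exact: chart_image_open.
by move=> x [_ /fg].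
Qed.

Lemma smooth_on_flat U f m : open U -> smooth_on U f ->
  smooth_on U (fun p => flat m (f p)).
Proof.
by move=> oU sf c ac k; apply: Ck_flat (sf c ac k); exact: chart_image_open.
Qed.

Lemma smooth_on_sum U (I : Type) (r : seq I) (F : I -> M -> R) : open U ->
  (forall i, smooth_on U (F i)) -> smooth_on U (fun p => \sum_(i <- r) F i p).
Proof.
move=> oU sF; elim: r => [|i r IH].
  by apply: smooth_on_eq (smooth_on_cst U 0) => // p _; rewrite big_nil.
by apply: smooth_on_eq (smooth_onD oU (sF i) IH) => // p _; rewrite big_cons.
Qed.

(** The open sets [U] and the complement of [C] cover the manifold, and the product is identically 0
    on the second. *)
Lemma smooth_on_mul_supported U C f g : open U -> closed C -> C `<=` U ->
  (forall p, ~ C p -> g p = 0) -> smooth_on setT g -> smooth_on U f ->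
  smooth_on setT (fun p => g p * f p).
Proof.
move=> oU cC CU g0 sg sf; apply: smooth_on_local => p _.
have [Cp|nCp] := pselect (C p).
  exists U; split => //; first exact: CU.
  by apply: smooth_onM => //; exact: smooth_onS sg.
exists (~` C); split => //; first exact: closed_openC.
apply: smooth_on_eq (smooth_on_cst (~` C) 0); first exact: closed_openC.
by move=> q /g0 ->; rewrite mul0r.
Qed.

(** A smooth step from 1 down to 0 when [a < b]: since exp(-1/t) increases, the quotient of flat
    values reaches 1 at [t = b], where the outer [flat 0] switches off. The factor [expR 1]
    normalizes [flat 0 1] to 1. *)
Definition cutoff a b (t : R) : R :=
  expR 1 * flat 0 (1 - (flat 0 (b - a))^-1 * flat 0 (t - a)).

Lemma cutoff_eq1 a b t : t <= a -> cutoff a b t = 1.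
Proof.
move=> ta; rewrite /cutoff (@flat_le0 _ 0 (t - a)) ?subr_le0 // mulr0 subr0.
by rewrite /flat ltr01 expr0 invr1 mul1r expRN mulfV // gt_eqF // expR_gt0.
Qed.

Lemma cutoff_eq0 a b t : a < b -> b <= t -> cutoff a b t = 0.
Proof.
move=> ab bt; have ba0 : 0 < b - a by rewrite subr_gt0.
have ta0 : 0 < t - a by rewrite subr_gt0 (lt_le_trans ab).
have F0 : 0 < flat 0 (b - a) by rewrite /flat ba0 expr0 invr1 mul1r expR_gt0.
rewrite /cutoff flat_le0 ?mulr0 // subr_le0 mulrC ler_pdivlMr // mul1r.
rewrite /flat ba0 ta0 expr0 !invr1 !mul1r ler_expR lerN2 lef_pV2 ?posrE //.
by rewrite lerD2r.
Qed.

Lemma smooth_on_cutoff U f a b : open U -> smooth_on U f ->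
  smooth_on U (fun p => cutoff a b (f p)).
Proof.
move=> oU sf; apply: smooth_onM => //; first exact: smooth_on_cst.
have scst r := smooth_on_cst U r.
apply: smooth_on_flat => //; apply: smooth_on_eq (smooth_onD oU (scst 1)
  (smooth_onM oU (scst (- (flat 0 (b - a))^-1))
    (smooth_on_flat 0 oU (smooth_onD oU sf (scst (- a)))))) => // p _.
by rewrite mulNr.
Qed.

(** The support is the image under a chart of a closed box; it is compact, hence closed because the
    manifold is Hausdorff. *)
Lemma bump_function U p : open U -> U p ->
  exists (g : smooth_fun M) (C : set M), [/\ closed C, C `<=` U,
    (forall q, ~ C q -> g q = 0) & \forall q \near p, g q = 1].
Proof.
move=> oU Up; have [c ac cp] := mf_cover p.
pose x0 := ch_map c p.
have /nbhs_ballP[e /= e0 eU] : nbhs x0 (chart_image c U).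
  apply: open_nbhs_nbhs; split; first exact: chart_image_open.
  by split; [exact: ch_map_cod|rewrite ch_mapK].
(* Halving the radius keeps the closed box inside the open ball of radius [e]. *)
pose eps := e / 2; have eps0 : 0 < eps by rewrite divr_gt0.
pose I (i : 'I_n) : set R := `[x0 0 i - eps, x0 0 i + eps]%classic.
pose box := [set v : 'rV[R]_n | forall i, I i (v 0 i)].
have boxE v : box v <-> forall i, `|v 0 i - x0 0 i| <= eps.
  by split => h i; have := h i; rewrite /I /= in_itv /= ler_distl.
have boxU : box `<=` chart_image c U.
  move=> v /boxE h; apply: eU; split=> // i j; rewrite (ord1 i) /ball /= distrC.
  by apply: le_lt_trans (h j) _; rewrite /eps; lra.
pose C := ch_inv c @` box.
have CU : C `<=` U by move=> q [v /boxU[_ Uv] <-].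
have Cdom : C `<=` ch_dom c by move=> q [v /boxU[cv _] <-]; exact: ch_inv_dom.
have cC : closed C.
  apply: compact_closed; first exact: mf_hausdorff.
  apply: continuous_compact.
    apply: continuous_in_subspaceT => v; rewrite inE => /boxU[cv _].
    exact: ch_inv_cont.
  by apply: (@rV_compact R n I) => i;
    exact: segment_compact.
(* The squared Euclidean distance to [x0] is smooth in the chart, unlike the sup norm that defines
   the balls. *)
pose r (q : M) := \sum_(i < n) (ch_map c q 0 i - x0 0 i) ^+ 2.
have sr : smooth_on (ch_dom c) r.
  have oc := ch_dom_open c.
  apply: smooth_on_sum => // i.
  have sd : smooth_on (ch_dom c) (fun q => ch_map c q 0 i - x0 0 i).
    apply: smooth_onD => //; last exact: smooth_on_cst.
    by move=> d ad; exact: mf_compat.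
  exact: smooth_onM.
(* The sup-norm ball of radius [del] lies in r <= n del^2 = [a], and [r < b] forces the box of
   half-width [eps]. Dividing by n+1 gives [a < b], also when n = 0. *)
pose del := eps / n.+1%:R.
have n0 : 0 < n.+1%:R :> R by rewrite ltr0n.
have del0 : 0 < del by rewrite divr_gt0.
pose a := n%:R * del ^+ 2; pose b := eps ^+ 2.
have ab : a < b.
  rewrite /a /b /del expr_div_n mulrCA -[ltRHS]mulr1 ltr_pM2l ?exprn_gt0 //.
  rewrite ltr_pdivrMr ?exprn_gt0 // mul1r -natrX ltr_nat.
  by apply: leq_trans (ltnSn n) _; rewrite leq_pmulr.
(* Outside the domain of the chart [ch_map] carries no information, so 0 is imposed there. *)
pose g q := if `[< ch_dom c q >] then cutoff a b (r q) else 0.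
have gE q : ch_dom c q -> g q = cutoff a b (r q) by rewrite /g; case: asboolP.
have g0 q : ~ C q -> g q = 0.
  rewrite /g; case: asboolP => // cq nCq; apply: cutoff_eq0 => //.
  rewrite leNgt; apply/negP => rb; apply: nCq.
  exists (ch_map c q); last exact: ch_mapK.
  apply/boxE => i; rewrite -ler_sqr ?nnegrE ?(ltW eps0) //.
  rewrite real_normK ?num_real //.
  apply: le_trans (ltW rb); rewrite /r (bigD1 i) //= lerDl.
  by apply: sumr_ge0 => j _; exact: sqr_ge0.
have sg : smooth_on setT g.
  apply: smooth_on_local => q _; have [Cq|nCq] := pselect (C q).
    exists (ch_dom c); split; [exact: ch_dom_open|exact: Cdom|].
    apply: smooth_on_eq (smooth_on_cutoff a b (ch_dom_open c) sr).
      exact: ch_dom_open.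
    by move=> q' /gE.
  exists (~` C); split => //; first exact: closed_openC.
  apply: smooth_on_eq (smooth_on_cst (~` C) 0); first exact: closed_openC.
  by move=> q' /g0.
exists (mk_smooth sg), C; split => //=.
have nd : \forall q \near p, ch_dom c q.
  by apply: open_nbhs_nbhs; split => //; exact: ch_dom_open.
have nb : \forall q \near p, ball x0 del (ch_map c q).
  by apply: (ch_map_cont cp); exact: nbhsx_ballx.
near=> q.
have cq : ch_dom c q by near: q.
rewrite gE //; apply: cutoff_eq1.
have bq : ball x0 del (ch_map c q) by near: q.
apply: (@le_trans _ _ (\sum_(i < n) del ^+ 2)).
  apply: ler_sum => i _; rewrite -(real_normK (num_real (_ - _))).
  rewrite ler_sqr ?nnegrE ?(ltW del0) //.
  by have := bq.2 0 i; rewrite /ball /= distrC => /ltW.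
by rewrite sumr_const card_ord /a mulr_natl.
Unshelve. all: by end_near.
Qed.
End SmoothFunctions.

(** * Vector fields as derivations of smooth functions *)

Section VectorFields.
Variables (R : realType) (n : nat) (M : manifold R n).
Implicit Types (X Y : vector_field M) (f g h : smooth_fun M).

Lemma vf_app_linear X (a : R) f g :
  vf_app X (const_fun M a * f + g) = const_fun M a * vf_app X f + vf_app X g.
Proof. by apply: smooth_fun_ext => p; rewrite /= tg_linear. Qed.

Lemma vf_appM X f g : vf_app X (f * g) = f * vf_app X g + vf_app X f * g.
Proof. by apply: smooth_fun_ext => p; rewrite /= tg_leibniz. Qed.

Lemma vf_app_linearl h X Y f :
  vf_app (h *: X + Y) f = h * vf_app X f + vf_app Y f.
Proof. exact: smooth_fun_ext. Qed.

Lemma smooth_fun1B f p : (1 - f) p = 1 - f p.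
Proof. by []. Qed.

End VectorFields.

(** * Existence of a linear connection on a vector bundle *)

Section Connections.
Variables (R : realType) (n : nat) (M : manifold R n) (E : vector_bundle M).
Implicit Types (X Y : vector_field M) (x y : section E) (f w : smooth_fun M)
  (D : vector_field M -> section E -> section E).

Lemma vb_smooth_local U (s : forall p, vb_fib E p) :
  (forall p, U p -> exists W, [/\ open W, W p & vb_smooth W s]) ->
  vb_smooth U s.
Proof.
move=> loc e ae i; apply: smooth_on_local => p [/loc[W [oW Wp sW]] ep].
exists (W `&` fr_dom e); split=> //; last exact: sW.
by apply: openI => //; exact: vb_open.
Qed.

Lemma vb_smooth_eq U (s t : forall p, vb_fib E p) : open U ->
  (forall p, U p -> s p = t p) -> vb_smooth U s -> vb_smooth U t.
Proof.
move=> oU st ss e ae i; apply: smooth_on_eq (ss e ae i).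
  by apply: openI => //; exact: vb_open.
by move=> p [/st ->].
Qed.

Lemma vb_smoothS U V (s : forall p, vb_fib E p) : V `<=` U ->
  vb_smooth U s -> vb_smooth V s.
Proof.
by move=> VU ss e ae i; apply: smooth_onS (ss e ae i); exact: setSI.
Qed.

Definition weighted_connection w D : Prop :=
  [/\ (forall x, linear (D^~ x)),
      (forall (a : R) X x y,
         D X (const_fun M a *: x + y) = const_fun M a *: D X x + D X y) &
      (forall X f x, D X (f *: x) = f *: D X x + (w * vf_app X f) *: x)].

Lemma local_connection p :
  exists w D, weighted_connection w D /\ \forall q \near (p : M), w q = 1.
Proof.
have [e ae ep] := vb_cover E p.
have oe := vb_open ae.
have [g [C [cC CU g0 g1]]] := bump_function oe ep.
have sc x j : smooth_on setT (fun q => g q * coord (e q) j (x q)).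
  apply: (smooth_on_mul_supported oe cC CU g0 (smooth_funP g)).
  by have := (secP x : vb_smooth setT x) e ae j; rewrite setTI.
pose c j x : smooth_fun M := mk_smooth (sc x j).
have ss j : vb_smooth (E := E) setT (fun q => g q *: tnth (e q) j).
  apply: vb_smooth_local => q _; have [Cq|nCq] := pselect (C q).
    exists (fr_dom e); split=> //; first exact: CU.
    apply: (@sf_smoothZ _ _ _ (vb_family E)) => //.
      exact: smooth_onS (smooth_funP g).
    by move=> e' ae' i; rewrite setIC; exact: vb_compat.
  have oC := closed_openC cC.
  exists (~` C); split => //.
  apply: vb_smooth_eq (sf_smooth0 (vb_family E) oC) => // q' /g0 /= ->.
  by rewrite scale0r.
pose s j : section E := @Section_ R n M (vb_family E) _ (ss j).
have cZD f j x y : c j (f *: x + y) = f * c j x + c j y.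
  apply: smooth_fun_ext => q; rewrite smooth_funD smooth_funM /=.
  by rewrite linearD linearZ /=; ring.
have cZ f j x : c j (f *: x) = f * c j x.
  by apply: smooth_fun_ext => q; rewrite smooth_funM /= linearZ /=; ring.
exists (g * g), (fun X x => \sum_j vf_app X (c j x) *: s j); split; first split.
- move=> x h X Y; rewrite scaler_sumr -big_split; apply: eq_bigr => j _ /=.
  by rewrite vf_app_linearl scalerDl scalerA.
- move=> a X x y; rewrite scaler_sumr -big_split; apply: eq_bigr => j _ /=.
  by rewrite cZD vf_app_linear scalerDl scalerA.
- move=> X f x.
  (* On [C] this is the frame expansion of [x q], with one factor [g] from [c j] and one from [s j];
     off [C] both sides vanish. *)
  have -> : (g * g * vf_app X f) *: x = \sum_j (vf_app X f * c j x) *: s j.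
    apply: sec_ext => q.
    rewrite (@big_morph _ _ (fun z : section E => z q) 0 +%R) //.
    rewrite sec_scaleE !smooth_funM.
    have [Cq|nCq] := pselect (C q); last first.
      rewrite g0 // !mul0r scale0r big1 // => j _.
      by rewrite sec_scaleE /= g0 // scale0r scaler0.
    rewrite {1}(coord_basis (vb_basis ae (CU _ Cq)) (memvf (x q))) scaler_sumr.
    apply: eq_bigr => j _; rewrite sec_scaleE smooth_funM /=.
    rewrite (tnth_nth 0) !scalerA.
    by congr (_ *: _); ring.
  rewrite scaler_sumr -big_split; apply: eq_bigr => j _ /=.
  by rewrite cZ vf_appM scalerDl scalerA.
- near=> q; rewrite smooth_funM (_ : g q = 1) ?mulr1 //; near: q; exact: g1.
Unshelve. all: by end_near.
Qed.

Lemma connection_exists : exists D, weighted_connection 1 D.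
Proof.
have wc0 : weighted_connection 0 (fun _ _ => 0).
  split.
  - by move=> x a X Y; rewrite scaler0 addr0.
  - by move=> a X x y; rewrite scaler0 addr0.
  - by move=> X f x; rewrite mul0r scale0r scaler0 addr0.
have [B cB [Bo Bb]] := mf_second_countable M.
have /countable_injP[num num_inj] := cB.
(* [good i] asks for weight 1 on the basic open set numbered [i]. [best i] can be met for every [i],
   with the zero operator of weight 0 as default when nothing is good. *)
pose good i (wD : smooth_fun M * _) := weighted_connection wD.1 wD.2 /\
  exists2 b, B b & num b = i /\ forall q, b q -> wD.1 q = 1.
pose best i (wD : smooth_fun M * _) := weighted_connection wD.1 wD.2 /\
  ((exists wD', good i wD') -> good i wD).
have [wD wDP] : {wD & forall i, best i (wD i)}.
  apply: choice => i; have [[wD' gi]|ng] := pselect (exists wD', good i wD').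
    by exists wD'; split=> //; case: gi.
  by exists (0, fun _ _ => 0).
have wD1 (p : M) : exists i, \forall q \near p, (wD i).1 q = 1.
  have [w [D [cD w1]]] := local_connection p.
  have [b [Bb' bp] bw] := Bb p _ w1.
  have gb : good (num b) (w, D) by split=> //; exists b.
  have [_ /(_ (ex_intro _ _ gb))[_ [b' Bb'' [nb b'1]]]] := wDP (num b).
  exists (num b); apply: filterS b'1 _.
  (* The operator chosen at index [num b] may come from another pair, but injectivity of [num]
     ensures that it has weight 1 on [b] itself. *)
  have -> : b' = b by apply: num_inj; rewrite ?inE.
  by apply: open_nbhs_nbhs; split=> //; exact: Bo.
(* Here 1 - W_(i+1) = (1 - W_i)(1 - w_i): weight 1 at a point is reached once some w_i equals 1
   there, and the later corrections then vanish at that point. *)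
pose step i (WF : smooth_fun M * (vector_field M -> section E -> section E)) :=
  (WF.1 + (1 - WF.1) * (wD i).1,
   fun X x => WF.2 X x + (1 - WF.1) *: (wD i).2 X x).
pose F := fix F i := if i is j.+1 then step j (F j)
  else (0, fun _ _ => 0) : smooth_fun M * _.
have F1E j : (F j.+1).1 = (F j).1 + (1 - (F j).1) * (wD j).1 by [].
have F2E j X x :
  (F j.+1).2 X x = (F j).2 X x + (1 - (F j).1) *: (wD j).2 X x by [].
have FP i : weighted_connection (F i).1 (F i).2.
  elim: i => [|i [F1 F2 F3]]; first exact: wc0.
  have [D1 D2 D3] := (wDP i).1; rewrite /=.
  move: (F i) F1 F2 F3 => [W G] /= F1 F2 F3.
  split=> /=.
  - move=> x a X Y; rewrite F1 D1 !scalerDr !scalerA (mulrC a) -!addrA.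
    by congr (_ + _); rewrite addrCA.
  - move=> a X x y; rewrite F2 D2 !scalerDr !scalerA (mulrC (const_fun M a)).
    by rewrite -!addrA; congr (_ + _); rewrite addrCA.
  - move=> X f x; rewrite F3 D3 !scalerDr (mulrDl W) (scalerDl x) !scalerA.
    rewrite (mulrC f (1 - W)) (mulrA (1 - W)) -!addrA; congr (_ + _).
    by rewrite addrCA.
have Fstat i j q : (i <= j)%N -> (F i).1 q = 1 ->
    (F j).1 q = 1 /\ forall X x, (F j).2 X x q = (F i).2 X x q.
  move=> ij Fi; elim: j ij => [|j IH].
    by rewrite leqn0 => /eqP ij; move: Fi; rewrite ij.
  rewrite leq_eqVlt => /predU1P[<- //|/IH[Fj Fij]]; split=> [|X x].
    rewrite F1E smooth_funD smooth_funM (_ : (1 - (F j).1) q = 0).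
      by rewrite mul0r addr0.
    by rewrite smooth_fun1B Fj subrr.
  rewrite F2E sec_addE sec_scaleE smooth_fun1B Fj subrr scale0r addr0.
  exact: Fij.
have Floc (p : M) : exists N, \forall q \near p, (F N).1 q = 1.
  have [i wi] := wD1 p; exists i.+1; near=> q.
  rewrite F1E smooth_funD smooth_funM smooth_fun1B (_ : (wD i).1 q = 1).
    by rewrite mulr1 addrC subrK.
  by near: q.
have [N NP] := choice Floc.
have F1 p : (F (N p)).1 p = 1 := nbhs_singleton (NP p).
have FN i j q X x : (F i).1 q = 1 -> (F j).1 q = 1 ->
    (F i).2 X x q = (F j).2 X x q.
  move=> Fi Fj; have [ij|/ltnW ji] := leqP i j.
    by have [_ ->] := Fstat _ _ _ ij Fi.
  by have [_ ->] := Fstat _ _ _ ji Fj.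
(* The stage [N q] is an arbitrary choice at each [q]; by [FN] the single stage [N p] gives the same
   values on a neighbourhood of [p], whence smoothness. *)
have sD X x : vb_smooth (E := E) setT (fun q => (F (N q)).2 X x q).
  apply: vb_smooth_local => p _.
  pose W := interior [set q | (F (N p)).1 q = 1].
  have oW : open W by exact: open_interior.
  exists W; split=> //; first exact: NP.
  apply: (@vb_smooth_eq _ ((F (N p)).2 X x)) => //.
    by move=> q /interior_subset Wq; exact: FN.
  exact: (@vb_smoothS setT W _ (@subsetT _ W) (secP ((F (N p)).2 X x))).
exists (fun X x => @Section_ R n M (vb_family E) _ (sD X x)); split.
- move=> x a X Y; apply: sec_ext => q /=.
  by have [-> _ _] := FP (N q).
- move=> a X x y; apply: sec_ext => q /=.
  by have [_ -> _] := FP (N q).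
- move=> X f x; apply: sec_ext => q /=.
  have [_ _ ->] := FP (N q).
  by rewrite !sec_addE !sec_scaleE !smooth_funM F1.
Unshelve. all: by end_near.
Qed.

End Connections.

(** * Action of bundle maps on sections *)

Section BundleMaps.
Variables (R : realType) (n : nat) (M : manifold R n) (E F : sfamily M).
Variable h : bundle_map E F.

Lemma bm_appD s t : bm_app h (s + t) = bm_app h s + bm_app h t.
Proof. by apply: sec_ext => p /=; rewrite linearD. Qed.

Lemma bm_appZ f s : bm_app h (f *: s) = f *: bm_app h s.
Proof. by apply: sec_ext => p /=; rewrite linearZ. Qed.

Lemma bm_appN s : bm_app h (- s) = - bm_app h s.
Proof. by rewrite -scaleN1r bm_appZ scaleN1r. Qed.

End BundleMaps.

(** * IM connection 1-forms and linear connections *)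

Section IMConnections.
Variables (R : realType) (n : nat) (M : manifold R n) (A : lie_algebroid M).
Variable k : forall p : M, {vspace vb_fib A p}.
Hypothesis hk : is_ideal_bundle k.
Variable l : bundle_map A A.
Hypothesis hl : is_splitting k l.

Local Notation "[[ x , y ]]" := (la_bracket x y).
Local Notation rho := (bm_app (la_anchor A)).

Lemma splitting_in x : section_in k (bm_app l x).
Proof. by move=> p; exact: hl.1. Qed.

Lemma splitting_id z : section_in k z -> bm_app l z = z.
Proof. by move=> kz; apply: sec_ext => p; exact: hl.2 (kz p). Qed.

Lemma rho_splitting x : rho (bm_app l x) = 0.
Proof.
apply: sec_ext => p; have [_ ker _] := hk.
by rewrite /= ker //; exact: splitting_in.
Qed.

Section FixedConnection.
Variable D : vector_field M -> section A -> section A.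
Hypothesis hD : is_connection D.

Lemma connDl X Y x : D (X + Y) x = D X x + D Y x.
Proof. by have [lin _ _] := hD; rewrite -[X in LHS]scale1r lin scale1r. Qed.

Lemma conn0l x : D 0 x = 0.
Proof. by apply: (addrI (D 0 x)); rewrite -connDl !addr0. Qed.

(** This is the second IM identity, [im_bracketl], for L = l o nabla. *)
Definition bracket_split :=
  forall x y, bm_app l [[x, y]] = [[x, bm_app l y]] - bm_app l (D (rho y) x).

(** As [rho] kills the image of [l], the left side of parallelism reduces to the bracket of [x] with
    [bm_app l y]. *)
Lemma l_parallelE : l_parallel D l <-> bracket_split.
Proof.
suff eqv x y : conn_A D x (bm_app l y) = bm_app l (conn_A D x y) <->
    bm_app l [[x, y]] = [[x, bm_app l y]] - bm_app l (D (rho y) x).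
  by split=> h x y; apply/eqv.
rewrite /conn_A rho_splitting conn0l add0r bm_appD; split=> [->|->].
  by rewrite addrC addKr.
by rewrite addrC subrK.
Qed.

(** Applying [bracket_split] to the brackets with [D X x] and [D X y] creates terms in D (rho (D X
    x)) y and D (rho (D X y)) x, which cancel the first summands of [conn_TM]. The remaining
    summands are those of the Lie derivatives. *)
Lemma bm_basic_curvature x y X : bracket_split ->
  bm_app l (basic_curvature D x y X) = bm_app l (D X [[x, y]]) -
    (lie_form x (fun Y => bm_app l (D Y y)) X -
     lie_form y (fun Y => bm_app l (D Y x)) X).
Proof.
move=> hB; rewrite /basic_curvature /conn_TM /lie_form (la_anti (D X x)) opprK.
rewrite !(bm_appD, bm_appN) !connDl !bm_appD !hB.
(* What remains is a cancellation in an abelian group, so all terms are generalized. *)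
move: (bm_app l (D X [[x, y]])) [[y, bm_app l (D X x)]] [[x, bm_app l (D X y)]].
move: (bm_app l (D (rho (D X x)) y)) (bm_app l (D (rho (D X y)) x)).
move: (bm_app l (D (vf_bracket (rho x) X) y)).
move: (bm_app l (D (vf_bracket (rho y) X) x)).
move=> a b c d e f g.
rewrite !opprB !opprD !addrA (addrAC _ d) addrK (addrAC _ (- c) (- g)).
by rewrite (addrAC _ (- c)) subrK (addrAC _ (- g)) (addrAC _ (- g)).
Qed.

Lemma IM_connection_of_flat : l_parallel D l -> l_basic_flat D l ->
  is_IM_connection k (fun x X => bm_app l (D X x)) l.
Proof.
move=> /l_parallelE hB flat; have [D1 D2 D3] := hD; split=> //.
- move=> x; split=> [f X Y|X]; last exact: splitting_in.
  by rewrite D1 bm_appD bm_appZ.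
- by move=> a x y X; rewrite D2 bm_appD bm_appZ.
- by move=> f x X; rewrite D3 bm_appD !bm_appZ.
- by move=> x y X; apply/eqP; rewrite -subr_eq0 -bm_basic_curvature ?flat.
Qed.

End FixedConnection.

Lemma connection_of_IM L : is_IM_connection k L l ->
  exists D, [/\ is_connection D, l_parallel D l, l_basic_flat D l &
    forall x X, L x X = bm_app l (D X x)].
Proof.
move=> [_ form lin leib bL bl].
have [nab [D1 D2 D3] ] := connection_exists A.
(* The component of [nab] along [k] is replaced by [L]; as [l] is the identity on [k], this gives
   [LE]. *)
pose D X x := nab X x - bm_app l (nab X x) + L x X.
have LE x X : L x X = bm_app l (D X x).
  rewrite !(bm_appD, bm_appN) (splitting_id (splitting_in _)) subrr add0r.
  by rewrite splitting_id //; exact: (form x).2.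
have hD : is_connection D.
  split.
  - move=> x f X Y; rewrite /D D1 (form x).1 bm_appD bm_appZ !scalerDr scalerN.
    by rewrite opprD (addrACA (f *: _)) (addrACA (f *: _ - _)).
  - move=> a X x y; rewrite /D D2 lin bm_appD bm_appZ !scalerDr scalerN opprD.
    by rewrite (addrACA (_ *: _)) (addrACA (_ *: _ - _)).
  - move=> X f x; rewrite /D D3 mul1r leib bm_appD !bm_appZ !scalerDr scalerN.
    rewrite opprD (addrACA (f *: _)) (addrACA (f *: _ - _)).
    (* The term X(f) l(x) removed with l o nabla is restored by the Leibniz rule of [L]. *)
    by rewrite subrK.
have hB : bracket_split D by move=> x y; rewrite bl LE.
exists D; split=> //; first exact/l_parallelE.
(* Through [LE] the curvature becomes the defect of the IM bracket identity for [L], which is zero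
   by [bL]. *)
move=> x y X; rewrite bm_basic_curvature // -LE bL /lie_form !LE.
by rewrite subrr.
Qed.

End IMConnections.

Theorem proposition5p9 (R : realType) (n : nat) (M : manifold R n)
    (A : lie_algebroid M) (k : forall p : M, {vspace vb_fib A p})
    (hk : is_ideal_bundle k) :
  [/\ partially_split k <->
      (exists (l : bundle_map A A)
         (D : vector_field M -> section A -> section A),
         [/\ is_splitting k l, is_connection D, l_parallel D l &
             l_basic_flat D l]),
      forall (l : bundle_map A A)
        (D : vector_field M -> section A -> section A),
        is_splitting k l -> is_connection D -> l_parallel D l ->
        l_basic_flat D l ->
        is_IM_connection k
          (fun (x : section A) (X : vector_field M) => bm_app l (D X x)) l &
      forall (L : section A -> vector_field M -> section A)
        (l : bundle_map A A),
        is_IM_connection k L l ->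
        exists D : vector_field M -> section A -> section A,
          [/\ is_connection D, l_parallel D l, l_basic_flat D l &
              forall (x : section A) (X : vector_field M),
                L x X = bm_app l (D X x)]].
Proof.
split=> [|l D hl hD par fl|L l im]; first split.
- move=> [L [l im]]; have hl := im_splitting im.
  have [D [hD par fl _]] := connection_of_IM hk hl im.
  by exists l, D.
- move=> [l [D [hl hD par fl]]].
  by exists (fun x X => bm_app l (D X x)), l; exact: IM_connection_of_flat.
- exact: IM_connection_of_flat.
- exact: (connection_of_IM hk (im_splitting im) im).
Qed.
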